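(* If $S=\langle X\rangle$ is an $E$-unitary inverse monoid with a sprawling Schützenberger graph of $1$, then $S$ is $F$-inverse.
   Context: An inverse monoid is a monoid $S$ in which every $s$ has a unique $s^{-1}$ with $ss^{-1}s=s$ and $s^{-1}ss^{-1}=s^{-1}$. $S=\langle X\rangle$ means $S$ is generated as an inverse monoid by (the image of) $X$. The natural partial order is $s\le t$ iff $s=te$ for some idempotent $e$. Elements $s,t$ are $\mathcal{R}$-related iff $ss^{-1}=tt^{-1}$. The maximal group image is $G=S/\sigma$, where $\sigma$ is the least congruence identifying all idempotents; $\sigma\colon S\to G$ also denotes the natural homomorphism. $S$ is $E$-unitary if $\sigma$ is injective on each $\mathcal{R}$-class. $S$ is $F$-inverse if every $\sigma$-class has a maximum element in the natural partial order. The Cayley graph of $S$ has vertex set $S$ and edges $s\xrightarrow{x}sx$ for $s\in S$, $x\in X\cup X^{-1}$. The Schützenberger graph $S\Gamma(s)$ is the strongly connected component containing $s$; its vertex set is the $\mathcal{R}$-class of $s$. When $S$ is $E$-unitary, $\sigma$ embeds each Schützenberger graph in the Cayley graph $\Gamma(G)$ of $G$ with respect to $X$. Write $S\Gamma$ for the embedded copy of $S\Gamma(1)$ in $\Gamma(G)$, i.e. the image of $S\Gamma(1)$ under $\sigma$, and $gS\Gamma$ for its translate by $g\in G$ under the left action of $G$ on $\Gamma(G)$. $S\Gamma$ (equivalently, the Schützenberger graph of $1$) is called sprawling if for every $g\in G$ the intersection $S\Gamma\cap gS\Gamma$ is non-empty. *)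

(* Defs.v *)
From HB Require Import structures.
From Stdlib Require Import Relations.
From mathcomp Require Import all_boot.
From mathcomp Require Import boolp classical_sets.

Set Implicit Arguments.
Unset Strict Implicit.
Unset Printing Implicit Defensive.

Local Open Scope classical_set_scope.
Local Open Scope quotient_scope.
Local Open Scope group_scope.

(** * Inverse monoids *)

(* The involution laws of [starMonoidType] hold in every inverse monoid: the
   factory [Monoid_isInverseMonoid] below derives them from the existence and
   uniqueness of inverses alone. *)
HB.mixin Record StarMonoid_isInverseMonoid S of BaseGroup S := {
  mulgVg_inverse : forall s : S, s * s^-1 * s = s;
  mulVgV_inverse : forall s : S, s^-1 * s * s^-1 = s^-1;
  inverse_unique : forall s t : S, s * t * s = s -> t * s * t = t -> t = s^-1
}.

#[short(type="inverseMonoidType")]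
HB.structure Definition InverseMonoid :=
  {S of StarMonoid_isInverseMonoid S & StarMonoid S}.

HB.factory Record Monoid_isInverseMonoid S of Monoid S & BaseGroup S := {
  mulgVg_inverse : forall s : S, s * s^-1 * s = s;
  mulVgV_inverse : forall s : S, s^-1 * s * s^-1 = s^-1;
  inverse_unique : forall s t : S, s * t * s = s -> t * s * t = t -> t = s^-1
}.

HB.builders Context S of Monoid_isInverseMonoid S.

Fact invgK : involutive (@inv S).
Proof.
move=> s; apply/esym/inverse_unique; [exact: mulVgV_inverse|exact: mulgVg_inverse].
Qed.

Fact idemM (e f : S) : e * e = e -> f * f = f -> (e * f) * (e * f) = e * f.
Proof.
move=> ee ff; set x := (e * f)^-1.
have xP : x * e * f * x = x by rewrite -(mulgA x) mulVgV_inverse.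
have xPA : f * x * e * f * x * e = f * x * e.
  by rewrite -[in RHS]xP !mulgA.
have fxe : f * x * e = x.
  apply: inverse_unique; rewrite !mulgA.
    by rewrite -(mulgA e f f) ff -(mulgA _ e e) ee -mulgA mulgVg_inverse.
  by rewrite -(mulgA _ e e) ee -(mulgA _ f f) ff.
have xx : x * x = x by rewrite -{1 2}fxe !mulgA xPA.
have -> : e * f = x; last by [].
rewrite -[LHS]invgK -/x; apply/esym.
by apply: inverse_unique; rewrite !xx.
Qed.

Fact idemC (e f : S) : e * e = e -> f * f = f -> e * f = f * e.
Proof.
move=> ee ff.
have idem g : g * g = g -> g = g^-1 :> S.
  by move=> gg; apply: inverse_unique; rewrite !gg.
rewrite [LHS]idem; last exact: idemM.
apply/esym/inverse_unique; rewrite !mulgA.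
  by rewrite -(mulgA e f f) ff -(mulgA _ e e) ee -mulgA idemM.
by rewrite -(mulgA f e e) ee -(mulgA _ f f) ff -mulgA idemM.
Qed.

Fact invgM : {morph @inv S : s t / s * t >-> t * s}.
Proof.
move=> s t; apply/esym/inverse_unique.
  have C : t * t^-1 * (s^-1 * s) = s^-1 * s * (t * t^-1).
    by apply: idemC; rewrite mulgA ?mulgVg_inverse ?mulVgV_inverse.
  rewrite -!mulgA (mulgA t) (mulgA s^-1 s) (mulgA _ _ t) C.
  by rewrite -(mulgA _ _ t) mulgVg_inverse !mulgA mulgVg_inverse.
have C : s^-1 * s * (t * t^-1) = t * t^-1 * (s^-1 * s).
  by apply: idemC; rewrite mulgA ?mulgVg_inverse ?mulVgV_inverse.
rewrite -!mulgA (mulgA s^-1) (mulgA t) (mulgA _ _ s^-1) C.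
by rewrite -(mulgA _ _ s^-1) mulVgV_inverse !mulgA mulVgV_inverse.
Qed.

HB.instance Definition _ := Monoid_isStarMonoid.Build S invgK invgM.
HB.instance Definition _ :=
  StarMonoid_isInverseMonoid.Build S mulgVg_inverse mulVgV_inverse inverse_unique.

HB.end.

Definition idempotent (S : magmaType) (e : S) : Prop := e * e = e.

Definition natural_le (S : magmaType) (s t : S) : Prop :=
  exists2 e : S, idempotent e & s = t * e.

Definition R_related (S : inverseMonoidType) (s t : S) : Prop :=
  s * s^-1 = t * t^-1.

(* [iota] need not be injective: this is generation by the image of [X]. *)
Definition generates (S : inverseMonoidType) (X : Type) (iota : X -> S) : Prop :=
  forall T : set S,
    T 1 ->
    (forall s t, T s -> T t -> T (s * t)) ->
    (forall s, T s -> T s^-1) ->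
    range iota `<=` T ->
    T = [set: S].

(** * The maximal group image *)

Definition congruence (S : magmaType) (rho : S -> S -> Prop) : Prop :=
  equivalence S rho /\
  forall a b c d, rho a b -> rho c d -> rho (a * c) (b * d).

Definition sigma_rel (S : magmaType) (s t : S) : Prop :=
  forall rho : S -> S -> Prop,
    congruence rho ->
    (forall e f, idempotent e -> idempotent f -> rho e f) ->
    rho s t.

Lemma sigma_rel_congruence (S : magmaType) : congruence (@sigma_rel S).
Proof.
split; first split.
- by move=> s rho [[r _ _] _] _; apply: r.
- by move=> s t u st tu rho H K; have [[_ tr _] _] := H;
    apply: (tr _ t); [apply: st|apply: tu].
- by move=> s t st rho H K; have [[_ _ sy] _] := H; apply: sy; apply: st.
- by move=> a b c d ab cd rho H K; have [_ m] := H; apply: m; [apply: ab|apply: cd].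
Qed.

Lemma sigma_rel_idempotent (S : magmaType) (e f : S) :
  idempotent e -> idempotent f -> sigma_rel e f.
Proof. by move=> ee ff rho _; apply. Qed.

Section MaximalGroupImage.
Variable S : inverseMonoidType.
Implicit Types s t : S.

Definition sigmab : rel S := fun s t => `[< sigma_rel s t >].

Local Lemma sigmab_refl : reflexive sigmab.
Proof.
by move=> s; apply/asboolP; have [[r _ _] _] := @sigma_rel_congruence S; apply: r.
Qed.

Local Lemma sigmab_sym : symmetric sigmab.
Proof.
have [[_ _ sy] _] := @sigma_rel_congruence S.
by move=> s t; apply/asboolP/asboolP; apply: sy.
Qed.

Local Lemma sigmab_trans : transitive sigmab.
Proof.
have [[_ tr _] _] := @sigma_rel_congruence S.
by move=> t s u /asboolP st /asboolP tu; apply/asboolP; apply: (tr _ t).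
Qed.

Definition sigma_equiv : equiv_rel S :=
  EquivRel sigmab sigmab_refl sigmab_sym sigmab_trans.

Definition max_group_image : Type := {eq_quot sigma_equiv}.

HB.instance Definition _ := Choice.on max_group_image.
HB.instance Definition _ := EqQuotient.on max_group_image.

Definition sigma (s : S) : max_group_image := \pi s.

Lemma sigmaP s t : sigma s = sigma t <-> sigma_rel s t.
Proof.
split=> [/eqP|st]; last by apply/eqmodP/asboolP.
by rewrite eqmodE => /asboolP.
Qed.

Lemma sigma_surj (g : max_group_image) : exists s, sigma s = g.
Proof. by exists (repr g); rewrite /sigma reprK. Qed.

Definition mulG (g h : max_group_image) : max_group_image := sigma (repr g * repr h).
Definition oneG : max_group_image := sigma 1.
Definition invG (g : max_group_image) : max_group_image := sigma (repr g)^-1.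

Local Lemma mulGE s t : mulG (sigma s) (sigma t) = sigma (s * t).
Proof.
apply/sigmaP; have [_] := @sigma_rel_congruence S.
by apply; apply/sigmaP; rewrite /sigma reprK.
Qed.

Local Lemma mulGA : associative mulG.
Proof.
move=> a b c; have [s <-] := sigma_surj a; have [t <-] := sigma_surj b.
by have [u <-] := sigma_surj c; rewrite !mulGE mulgA.
Qed.

Local Lemma mul1G : left_id oneG mulG.
Proof. by move=> a; have [s <-] := sigma_surj a; rewrite mulGE mul1g. Qed.

Local Lemma mulG1 : right_id oneG mulG.
Proof. by move=> a; have [s <-] := sigma_surj a; rewrite mulGE mulg1. Qed.

Local Lemma mulVG : left_inverse oneG invG mulG.
Proof.
move=> a; have -> : mulG (invG a) a = sigma ((repr a)^-1 * repr a).
  by rewrite -mulGE; congr mulG; rewrite /sigma reprK.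
apply/sigmaP; apply: sigma_rel_idempotent.
  by rewrite /idempotent mulgA mulVgV_inverse.
exact: mulg1.
Qed.

Local Lemma mulGV : right_inverse oneG invG mulG.
Proof.
move=> a; have -> : mulG a (invG a) = sigma (repr a * (repr a)^-1).
  by rewrite -mulGE; congr mulG; rewrite /sigma reprK.
apply/sigmaP; apply: sigma_rel_idempotent.
  by rewrite /idempotent mulgA mulgVg_inverse.
exact: mulg1.
Qed.

HB.instance Definition _ :=
  isGroup.Build max_group_image mulGA mul1G mulG1 mulVG mulGV.

Lemma sigmaM : {morph sigma : s t / s * t}.
Proof. by move=> s t; rewrite -mulGE. Qed.

Lemma sigma1 : sigma 1 = 1.
Proof. by []. Qed.

Lemma sigmaV : {morph sigma : s / s^-1}.
Proof.
move=> s; apply: (mulIg (sigma s)); rewrite mulVg -sigmaM -sigma1.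
apply/sigmaP; apply: sigma_rel_idempotent; last exact: mulg1.
by rewrite /idempotent mulgA mulVgV_inverse.
Qed.

End MaximalGroupImage.

Definition E_unitary (S : inverseMonoidType) : Prop :=
  forall s t : S, R_related s t -> sigma s = sigma t -> s = t.

Definition F_inverse (S : inverseMonoidType) : Prop :=
  forall g : max_group_image S,
    exists2 m : S, sigma m = g & forall s : S, sigma s = g -> natural_le s m.

(** * Labelled digraphs *)

(* An edge [(u, l, v)] goes from [u] to [v] and carries the label [l]. *)
Record digraph (V L : Type) := Digraph {
  vertices : set V;
  edges : set (V * L * V)
}.

Definition digraph_image (V W L : Type) (f : V -> W) (Gam : digraph V L) :
    digraph W L :=
  Digraph (f @` vertices Gam)
          ((fun e => (f e.1.1, e.1.2, f e.2)) @` edges Gam).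

Definition digraph_inter (V L : Type) (Gam Del : digraph V L) : digraph V L :=
  Digraph (vertices Gam `&` vertices Del) (edges Gam `&` edges Del).

Definition sub_digraph (V L : Type) (Gam Del : digraph V L) : Prop :=
  vertices Gam `<=` vertices Del /\ edges Gam `<=` edges Del.

Definition digraph_nonempty (V L : Type) (Gam : digraph V L) : Prop :=
  vertices Gam !=set0.

Definition reachable (V L : Type) (Gam : digraph V L) : V -> V -> Prop :=
  clos_refl_trans V (fun u v => exists l, edges Gam (u, l, v)).

Definition induced_digraph (V L : Type) (Gam : digraph V L) (A : set V) :
    digraph V L :=
  Digraph (vertices Gam `&` A)
          (edges Gam `&` [set e | A e.1.1 /\ A e.2]).

Definition strong_component (V L : Type) (Gam : digraph V L) (u : V) :
    digraph V L :=
  induced_digraph Gam [set v | reachable Gam u v /\ reachable Gam v u].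

(** * Cayley and Schützenberger graphs *)

(* The alphabet [X \cup X^-1] is the disjoint sum [X + X]; the second summand
   holds the formal inverses. *)
Definition letter (M : baseGroupType) (X : Type) (iota : X -> M) (x : X + X) : M :=
  match x with inl y => iota y | inr y => (iota y)^-1 end.

Definition cayley_graph (M : baseGroupType) (X : Type) (iota : X -> M) :
    digraph M (X + X) :=
  Digraph [set: M] [set e | e.2 = e.1.1 * letter iota e.1.2].

Section Schutzenberger.
Variables (S : inverseMonoidType) (X : Type) (iota : X -> S).

Definition schutzenberger_graph (s : S) : digraph S (X + X) :=
  strong_component (cayley_graph iota) s.

Definition embedded_schutzenberger : digraph (max_group_image S) (X + X) :=
  digraph_image (@sigma S) (schutzenberger_graph 1).

Lemma embedded_schutzenberger_sub :
  sub_digraph embedded_schutzenberger (cayley_graph (@sigma S \o iota)).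
Proof.
split=> // _ [[[s l] t] [/= -> _] <-] /=; rewrite sigmaM.
by case: l => x //=; rewrite sigmaV.
Qed.

Definition sprawling : Prop :=
  forall g : max_group_image S,
    digraph_nonempty
      (digraph_inter embedded_schutzenberger
                     (digraph_image (fun h => g * h) embedded_schutzenberger)).

End Schutzenberger.

(* Main.v *)
From HB Require Import structures.
From mathcomp Require Import all_boot.
Require Import Defs.

Set Implicit Arguments.
Unset Strict Implicit.
Unset Printing Implicit Defensive.

Local Open Scope group_scope.

(** Vertices of the Schützenberger graph of [1] are right invertible, so
    sprawling writes every [g] as [sigma (u * v^-1)] with [u * u^-1 = 1] and
    [v * v^-1 = 1]. If [sigma s = g], then [s * v] and [s * s^-1 * u] are
    R-related (to [s]) and have the same image in [G], hence are equal;
    multiplying by [v^-1] gives [s = s * s^-1 * (u * v^-1)], so that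
    [u * v^-1] is the maximum of its class. *)

Section InverseMonoid.
Variable S : inverseMonoidType.
Implicit Types s t e f : S.

Lemma idempotent_mulgV s : idempotent (s * s^-1).
Proof. by rewrite /idempotent mulgA mulgVg_inverse. Qed.

Lemma idempotent_inv e : idempotent e -> e^-1 = e.
Proof. by move=> ee; apply/esym/inverse_unique; rewrite !ee. Qed.

(** As [(e * f)^-1 = f * e], the law [s * s^-1 * s = s] at [s = e * f] collapses to the claim. *)
Lemma idempotentM e f : idempotent e -> idempotent f -> idempotent (e * f).
Proof.
move=> ee ff; rewrite /idempotent -[RHS]mulgVg_inverse invgM !idempotent_inv //.
by rewrite !mulgA -(mulgA e f f) ff -(mulgA _ e e) ee.
Qed.

Lemma idempotentC e f : idempotent e -> idempotent f -> e * f = f * e.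
Proof.
move=> ee ff; rewrite -[LHS]idempotent_inv; last exact: idempotentM.
by rewrite invgM !idempotent_inv.
Qed.

(** An idempotent passes from the left of [t] to its right as the conjugate [t^-1 * e * t]. *)
Lemma natural_leMl e t : idempotent e -> natural_le (e * t) t.
Proof.
move=> ee; have C := idempotentC ee (idempotent_mulgV t).
have tet : t * (t^-1 * e * t) = e * t.
  by rewrite !mulgA -C -!mulgA (mulgA t) mulgVg_inverse.
exists (t^-1 * e * t); last by rewrite tet.
by rewrite /idempotent -[LHS]mulgA tet -!mulgA (mulgA e e) ee.
Qed.

Lemma sigma_idempotent e : idempotent e -> sigma e = 1.
Proof.
by move=> ee; apply/sigmaP; apply: sigma_rel_idempotent => //; apply: mulg1.
Qed.

Variables (X : Type) (iota : X -> S).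

Lemma reachable_cayley s t :
  reachable (cayley_graph iota) s t -> exists w, t = s * w.
Proof.
elim=> [u v [l /= ->]|u|u v w _ [a ->] _ [b ->]].
- by exists (letter iota l).
- by exists 1; rewrite mulg1.
- by exists (a * b); rewrite mulgA.
Qed.

Lemma schutzenberger_graph1_mulgV u :
  vertices (schutzenberger_graph iota 1) u -> u * u^-1 = 1.
Proof.
(* The path from [u] back to [1] spells a right inverse [w] of [u], and [u * u^-1] fixes [u * w]. *)
move=> [_ [_ /reachable_cayley[w uw]]].
by rewrite -[LHS]mulg1 uw mulgA mulgVg_inverse.
Qed.

Lemma sprawling_factorization (g : max_group_image S) : sprawling iota ->
  exists u v, [/\ u * u^-1 = 1, v * v^-1 = 1 & g = sigma (u * v^-1)].
Proof.
(* A common vertex is both [sigma u] and [g * sigma v]. *)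
move=> /(_ g)[_ [[u u1 <-] [_ [v v1 <-] gv]]].
exists u, v; split; try exact: schutzenberger_graph1_mulgV.
by rewrite sigmaM sigmaV -gv mulgK.
Qed.

Lemma E_unitary_natural_le s u v : E_unitary S ->
  u * u^-1 = 1 -> v * v^-1 = 1 -> sigma s = sigma (u * v^-1) ->
  natural_le s (u * v^-1).
Proof.
move=> SE uu vv sg.
have svE : s * v = s * s^-1 * u.
  apply: SE.
    rewrite /R_related !invgM invgK !mulgA -(mulgA s v) vv mulg1.
    by rewrite -(mulgA _ u) uu mulg1 mulgVg_inverse.
  (* Both sides map to [sigma u]. *)
  rewrite [RHS]sigmaM (sigma_idempotent (idempotent_mulgV s)) mul1g.
  by rewrite sigmaM sg sigmaM sigmaV mulgVK.
have -> : s = s * s^-1 * (u * v^-1) by rewrite mulgA -svE -mulgA vv mulg1.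
exact/natural_leMl/idempotent_mulgV.
Qed.

End InverseMonoid.

Theorem lemma4p10 (S : inverseMonoidType) (X : Type) (iota : X -> S)
    (X_generates_S : generates iota)
    (S_E_unitary : E_unitary S)
    (S_sprawling : sprawling iota) :
  F_inverse S.
Proof.
move=> g; have [u [v [uu vv ->]]] := sprawling_factorization g S_sprawling.
by exists (u * v^-1) => // s; apply: E_unitary_natural_le.
Qed.
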